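(* Let $b=\alpha+i\beta$ with $\alpha,\beta\in\mathbb{R}$, $b\neq-3$ and $b\neq1$. The fixed points $$z_{\pm}=\frac{11+6b-b^2\pm\sqrt{(5+10b+b^2)(17+2b-3b^2)}}{2(b-1)(b+3)}$$ of $O_b$ are indifferent if \begin{align*} &(5+10\alpha+\alpha^2)(-17-2\alpha+3\alpha^2)(-67-204\alpha-26\alpha^2+36\alpha^3+5\alpha^4)\\ &+4(8259+5994\alpha+1225\alpha^2-4\alpha^3+709\alpha^4+186\alpha^5+15\alpha^6)\beta^2\\ &+2(6069+1508\alpha+1606\alpha^2+372\alpha^3+45\alpha^4)\beta^4\\ &+4(299+62\alpha+15\alpha^2)\beta^6+15\beta^8=0. \end{align*}
   Context: For $b\in\mathbb{C}$, $O_b:\widehat{\mathbb{C}}\to\widehat{\mathbb{C}}$ is the rational map (after cancelling common factors) $$O_b(z)=z^4\,\frac{-11-6b+b^2+(-3+2b+b^2)z}{-3+2b+b^2+(-11-6b+b^2)z}.$$ For $b\neq -3,1$ the points $z_\pm$ are fixed points of $O_b$. A fixed point $z_0$ of a rational map $R$ is indifferent if $|R'(z_0)|=1$. *)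

(* Defs.v *)
From HB Require Import structures.
From mathcomp Require Import all_boot all_order all_algebra.
From mathcomp Require Import complex.
From mathcomp Require Import classical_sets reals topology normedtype derive.
Set Implicit Arguments.
Unset Strict Implicit.
Unset Printing Implicit Defensive.
Import Order.TTheory GRing.Theory Num.Theory numFieldNormedType.Exports.
Local Open Scope ring_scope.
Local Open Scope complex_scope.
Local Open Scope classical_set_scope.

(* The packed type is needed: the library puts its topology and norm on the
   carrier of a [numFieldType], and does not find them from [R[i]] itself. *)
Definition cplx (R : realType) : numClosedFieldType := R[i].

(* [Some z] is the finite point z and [None] is the point at infinity. *)
Definition riemann_sphere (R : realType) : Type :=
  one_point_compactification (cplx R).

(* The self-map of the sphere induced by the quotient p / q (q != 0) once the
   common factors of p and q are cancelled.  At a finite pole the value is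
   infinity; the value at infinity compares the coefficients of degree
   d = max (deg p0, deg q0), which do not both vanish. *)
Definition rational_map (R : realType) (p q : {poly (cplx R)})
    (z : riemann_sphere R) : riemann_sphere R :=
  let p0 := p %/ gcdp p q in
  let q0 := q %/ gcdp p q in
  match z with
  | Some w => if q0.[w] == 0 then None else Some (p0.[w] / q0.[w])
  | None => let d := (maxn (size p0) (size q0)).-1 in
            if q0`_d == 0 then None else Some (p0`_d / q0`_d)
  end.

Definition O_map (R : realType) (b : cplx R) :
    riemann_sphere R -> riemann_sphere R :=
  rational_map
    ('X^4 * ((- 11 - 6 * b + b ^+ 2)%:P + (- 3 + 2 * b + b ^+ 2)%:P * 'X))
    ((- 3 + 2 * b + b ^+ 2)%:P + (- 11 - 6 * b + b ^+ 2)%:P * 'X).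

(* f read in the affine chart; the value 0 at the poles is a dummy. *)
Definition affine_part (R : realType)
    (f : riemann_sphere R -> riemann_sphere R) (z : cplx R) : cplx R :=
  odflt 0 (f (Some z)).

(* The derivative is the complex one: the scalar field is cplx R. *)
Definition indifferent_fixed_point (R : realType)
    (f : riemann_sphere R -> riemann_sphere R) (z0 : cplx R) : Prop :=
  [/\ f (Some z0) = Some z0,
      derivable (affine_part f) z0 1 &
      `| (affine_part f)^`() z0 | = 1].

Definition discr (R : realType) (b : cplx R) : cplx R :=
  (5 + 10 * b + b ^+ 2) * (17 + 2 * b - 3 * b ^+ 2).

(* [sqrtC] is a fixed choice of complex square root; the other choice exchanges
   [z_plus] and [z_minus]. *)
Definition z_plus (R : realType) (b : cplx R) : cplx R :=
  (11 + 6 * b - b ^+ 2 + sqrtC (discr b)) / (2 * (b - 1) * (b + 3)).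

Definition z_minus (R : realType) (b : cplx R) : cplx R :=
  (11 + 6 * b - b ^+ 2 - sqrtC (discr b)) / (2 * (b - 1) * (b + 3)).

(* Main.v *)
(* With A = b^2 - 6 b - 11 and B = b^2 + 2 b - 3 = (b - 1) (b + 3) one has
   O_b(z) = z^4 (A + B z) / (B + A z), and z_+ and z_- are the two roots of
   B z^2 + A z + B = 0.  At such a root A / B = - (z + 1 / z), which turns the
   derivative 3 - z^2 - 1 / z^2 into 5 - (A / B)^2: both fixed points have the
   same multiplier.  The polynomial condition on (alpha, beta) is
   |5 B^2 - A^2|^2 - |B|^4 = 0 written in real coordinates. *)
Require Import Defs.
From mathcomp Require Import all_boot all_order all_algebra.
From mathcomp Require Import complex reals.
From mathcomp Require Import boolp classical_sets functions topology normedtype derive.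
From mathcomp Require Import ring.
Import Order.TTheory GRing.Theory Num.Theory numFieldNormedType.Exports.
Local Open Scope ring_scope.
Local Open Scope complex_scope.

Section Derivatives.
Context {K : numFieldType}.
Implicit Types (p q : {poly K}) (x : K).

(* [derive.is_derive_poly] is stated for real fields only. *)
Lemma is_derive_horner p x : is_derive x 1 (horner p) p^`().[x].
Proof.
elim/poly_ind: p => [|p c IHp].
  rewrite (_ : horner 0 = cst 0); last by apply/funext => y; rewrite horner0.
  by rewrite deriv0 horner0; exact: is_derive_cst.
rewrite (_ : horner _ = horner p * id + cst c); last first.
  by apply/funext => y; rewrite hornerMXaddC.
apply: is_derive_eq.
rewrite derivMXaddC hornerD hornerM hornerX addr0 addrC.
by rewrite /GRing.scale /= mulr1 [x * _]mulrC addrC.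
Qed.

Lemma is_derive_horner_div p q x : q.[x] != 0 ->
  is_derive x 1 (fun w => p.[w] / q.[w])
    ((p^`().[x] * q.[x] - p.[x] * q^`().[x]) / q.[x] ^+ 2).
Proof.
move=> qx0.
have dp := is_derive_horner p x; have dq := is_derive_horner q x.
have dV : is_derive x 1 (fun w => (q.[w])^-1) (- q.[x] ^- 2 *: q^`().[x]).
  apply: DeriveDef; first exact: derivableV.
  by rewrite deriveV // derive_val.
rewrite (_ : (fun w => _) = horner p * (fun w => (q.[w])^-1)) //.
apply: is_derive_eq.
by rewrite /GRing.scale /=; field.
Qed.

End Derivatives.

Section RationalMap.
Context {R : realType}.
Implicit Types (p q : {poly cplx R}) (z : cplx R).

(** Away from the zeros of [q] the cancelled factor [g] is nonzero too, so values and derivatives of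
    the reduced fraction can be computed from [p] and [q] without knowing the gcd. *)
Lemma cancel_gcdp p q z : q.[z] != 0 ->
  exists g : {poly cplx R}, [/\ p = p %/ gcdp p q * g, q = q %/ gcdp p q * g,
    (q %/ gcdp p q).[z] != 0 & g.[z] != 0].
Proof.
move=> qz0; exists (gcdp p q).
have qE : q = q %/ gcdp p q * gcdp p q by rewrite divpK // dvdp_gcdr.
have := qz0; rewrite {1}qE hornerM mulf_eq0 negb_or => /andP[q0z0 gz0].
by split=> //; rewrite divpK // dvdp_gcdl.
Qed.

Lemma rational_map_fin p q z : q.[z] != 0 ->
  rational_map p q (Some z) = Some (p.[z] / q.[z]).
Proof.
move=> qz0; have [g [pE qE q0z0 gz0]] := cancel_gcdp p q z qz0.
rewrite /rational_map.
set p0 := p %/ _ in pE *; set q0 := q %/ _ in qE q0z0 *.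
rewrite (negbTE q0z0); congr Some.
by rewrite pE qE !hornerM; field; rewrite gz0.
Qed.

(* As [x / 0 = 0], the dummy value of [affine_part] at the poles is the one of
   the quotient of evaluations. *)
Lemma affine_rational_map p q :
  affine_part (rational_map p q)
  = fun w => (p %/ gcdp p q).[w] / (q %/ gcdp p q).[w].
Proof.
apply/funext => w; rewrite /affine_part /rational_map.
by case: eqP => [->|] //=; rewrite invr0 mulr0.
Qed.

(** Writing p = p0 g and q = q0 g, the terms in g' cancel in p' q - p q', which leaves g^2 (p0' q0 -
    p0 q0'); the factor g(z)^2 then cancels against q(z)^2. *)
Lemma is_derive_rational_map p q z : q.[z] != 0 ->
  is_derive z 1 (affine_part (rational_map p q))
    ((p^`().[z] * q.[z] - p.[z] * q^`().[z]) / q.[z] ^+ 2).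
Proof.
move=> qz0; have [g [pE qE q0z0 gz0]] := cancel_gcdp p q z qz0.
rewrite affine_rational_map.
set p0 := p %/ _ in pE *; set q0 := q %/ _ in qE q0z0 *.
have d0 := is_derive_horner_div p0 q0 z q0z0; apply: is_derive_eq.
rewrite pE qE !derivM !hornerD !hornerM; field.
by rewrite gz0.
Qed.

End RationalMap.

Section FixedPoints.
Context {R : realType}.
Implicit Types (A B s z : cplx R).

Lemma indifferent_palindromic_root A B z : B != 0 ->
  B * z ^+ 2 + A * z + B = 0 -> `|5 - (A / B) ^+ 2| = 1 ->
  indifferent_fixed_point
    (rational_map ('X^4 * (A%:P + B%:P * 'X)) (B%:P + A%:P * 'X)) z.
Proof.
move=> B0 hz hn.
set p := 'X^4 * _; set q := _ + _ * 'X.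
have z0 : z != 0.
  by apply: contraNneq B0 => zE; rewrite -hz zE expr0n /= !mulr0 !add0r.
(* The quadratic gives B + A z = - B z^2, so z is not a pole, and A + B z = - B / z, so the quotient
   at z is z^4 / z^3 = z. *)
have qz : q.[z] = - (B * z ^+ 2).
  rewrite /q !(hornerD, hornerM, hornerC, hornerX).
  by apply/eqP; rewrite -subr_eq0 -hz; apply/eqP; ring.
have pz : p.[z] = z * q.[z].
  rewrite qz /p !(hornerD, hornerM, hornerC, hornerX, hornerXn).
  have -> : A + B * z = - B / z.
    apply: (mulIf z0); rewrite divfK //; apply/eqP; rewrite -subr_eq0 -hz.
    by apply/eqP; ring.
  by field.
have qz0 : q.[z] != 0 by rewrite qz oppr_eq0 mulf_neq0 // expf_neq0.
have dlin c d : (c%:P + d%:P * 'X : {poly cplx R})^`() = d%:P.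
  by rewrite addrC derivMXaddC derivC mul0r addr0.
have dqz : q^`().[z] = A by rewrite dlin hornerC.
have dpz : p^`().[z] = 4 * z ^+ 3 * (A + B * z) + z ^+ 4 * B.
  rewrite derivM derivXn dlin.
  by rewrite !(hornerD, hornerM, hornerC, hornerX, hornerXn, hornerMn); ring.
(* Eliminating [A] turns the multiplier formula into an identity of rational functions in z and [B]
   alone. *)
have AE : A = - B * (z + z^-1).
  apply: (mulIf z0); apply/eqP; rewrite -subr_eq0 -hz; apply/eqP.
  by field.
have dz := is_derive_rational_map p q z qz0.
have lE : (p^`().[z] * q.[z] - p.[z] * q^`().[z]) / q.[z] ^+ 2
    = 5 - (A / B) ^+ 2.
  by rewrite dpz pz dqz qz AE; field; rewrite z0 B0.
rewrite lE in dz; split.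
- by rewrite rational_map_fin // pz mulfK.
- by case: dz.
- by rewrite derive1E; case: dz => _ ->.
Qed.

(** Any square root [s] of the discriminant is allowed: [sqrtC (discr b)] serves for [z_plus] and
    its opposite for [z_minus]. *)
Lemma quadratic_root A B s z : B != 0 -> s ^+ 2 = A ^+ 2 - 4 * B ^+ 2 ->
  z = (- A + s) / (2 * B) -> B * z ^+ 2 + A * z + B = 0.
Proof.
move=> B0 hs ->.
have -> : B * ((- A + s) / (2 * B)) ^+ 2 + A * ((- A + s) / (2 * B)) + B
    = (s ^+ 2 - (A ^+ 2 - 4 * B ^+ 2)) / (4 * B) by field.
by rewrite hs subrr mul0r.
Qed.

End FixedPoints.

(** Clearing B^2 and squaring the norms replaces the modulus condition by one that is polynomial in
    [A], [B] and their conjugates. *)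
Lemma norm_multiplier (R : realType) (A B : cplx R) : B != 0 ->
  `|5 * B ^+ 2 - A ^+ 2| ^+ 2 = `|B ^+ 2| ^+ 2 -> `|5 - (A / B) ^+ 2| = 1.
Proof.
move=> B0 /eqP; rewrite eqrXn2 ?normr_ge0 // => /eqP h.
have -> : 5 - (A / B) ^+ 2 = (5 * B ^+ 2 - A ^+ 2) / B ^+ 2 by field.
by rewrite normrM normfV h divff // normr_eq0 expf_neq0.
Qed.

Theorem proposition5 (R : realType) (alpha beta : R) (b : cplx R)
    (hb : b = alpha +i* beta) (hb3 : b != - 3) (hb1 : b != 1)
    (hab :
      (5 + 10 * alpha + alpha ^+ 2) * (- 17 - 2 * alpha + 3 * alpha ^+ 2)
        * (- 67 - 204 * alpha - 26 * alpha ^+ 2 + 36 * alpha ^+ 3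
           + 5 * alpha ^+ 4)
      + 4 * (8259 + 5994 * alpha + 1225 * alpha ^+ 2 - 4 * alpha ^+ 3
             + 709 * alpha ^+ 4 + 186 * alpha ^+ 5 + 15 * alpha ^+ 6)
          * beta ^+ 2
      + 2 * (6069 + 1508 * alpha + 1606 * alpha ^+ 2 + 372 * alpha ^+ 3
             + 45 * alpha ^+ 4) * beta ^+ 4
      + 4 * (299 + 62 * alpha + 15 * alpha ^+ 2) * beta ^+ 6
      + 15 * beta ^+ 8 = 0) :
  indifferent_fixed_point (O_map b) (z_plus b) /\
  indifferent_fixed_point (O_map b) (z_minus b).
Proof.
set A : cplx R := - 11 - 6 * b + b ^+ 2.
set B : cplx R := - 3 + 2 * b + b ^+ 2.
have BE : B = (b - 1) * (b + 3) by rewrite /B; ring.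
have B0 : B != 0 by rewrite BE mulf_neq0 // ?subr_eq0 // addr_eq0.
(* The two factors of [discr b] are 2 B - A and - (A + 2 B). *)
have hd : discr b = A ^+ 2 - 4 * B ^+ 2 by rewrite /discr /A /B; ring.
have hn : `|5 - (A / B) ^+ 2| = 1.
  apply: norm_multiplier => //.
  (* With t = i beta, conjugation of b = a + t only flips the sign of t, and t^2 = - beta^2 is the
     one relation needed to return to real coordinates. *)
  pose a : cplx R := alpha%:C; pose t : cplx R := 0 +i* beta.
  have bE : b = a + t.
    by rewrite hb; apply/eqP; rewrite eq_complex /= addr0 add0r !eqxx.
  have bC : Num.conj b = a - t.
    by rewrite hb; apply/eqP; rewrite eq_complex /= oppr0 addr0 add0r !eqxx.
  have t2 : t ^+ 2 = - (beta%:C : cplx R) ^+ 2.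
    apply/eqP; rewrite !expr2 eq_complex /=.
    by apply/andP; split; apply/eqP; ring.
  have /= habC := congr1 (fun x : R => x%:C : cplx R) hab.
  have AC : Num.conj A = - 11 - 6 * (a - t) + (a - t) ^+ 2.
    by rewrite /A -bC !(rmorph_nat, rmorphD, rmorphN, rmorphM, rmorphXn).
  have BC : Num.conj B = - 3 + 2 * (a - t) + (a - t) ^+ 2.
    by rewrite /B -bC !(rmorph_nat, rmorphD, rmorphN, rmorphM, rmorphXn).
  rewrite !normCK rmorphB rmorphM !rmorphXn rmorph_nat /= AC BC /A /B bE.
  (* The right-hand 0 becomes the polynomial of [hab] embedded in the complex numbers; it equals the
     difference of the two squared norms exactly, modulo [t2]. *)
  apply/eqP; rewrite -subr_eq0 -[X in _ == X]habC; apply/eqP.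
  by rewrite /a; ring: t2.
split; apply: indifferent_palindromic_root => //.
- apply: (quadratic_root A B (sqrtC (discr b))) => //; first by rewrite sqrtCK.
  by rewrite /z_plus BE mulrA /A; congr (_ / _); ring.
- apply: (quadratic_root A B (- sqrtC (discr b))) => //.
    by rewrite sqrrN sqrtCK.
  by rewrite /z_minus BE mulrA /A; congr (_ / _); ring.
Qed.
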